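(* Let $G$ be a finite group with a supercharacter theory $(\mathcal{S},\mathcal{S}^\vee)$. Then a subgroup $H\subset G$ is supernormal with respect to $(\mathcal{S},\mathcal{S}^\vee)$ if and only if there exist supercharacters $\chi_1,\dots,\chi_n\in\mathcal{S}$ with $H=\bigcap_{i=1}^n\ker\chi_i$.
   Context: Let $G$ be a finite group; characters are complex characters. A supercharacter theory of $G$ is a pair $(\mathcal{S},\mathcal{S}^\vee)$ where $\mathcal{S}$ is a set of characters of $G$ and $\mathcal{S}^\vee$ is a partition of the set $G$ such that: (1) $|\mathcal{S}|=|\mathcal{S}^\vee|$; (2) each irreducible character of $G$ appears as a constituent of exactly one $\chi\in\mathcal{S}$; (3) each $\chi\in\mathcal{S}$ is constant on each set $\mathcal{K}\in\mathcal{S}^\vee$; (4) $\{1\}\in\mathcal{S}^\vee$. Elements of $\mathcal{S}$ are called supercharacters and elements of $\mathcal{S}^\vee$ superclasses. A subgroup $H\subset G$ is supernormal with respect to $(\mathcal{S},\mathcal{S}^\vee)$ if $H$ is the union of a set of superclasses in $\mathcal{S}^\vee$. The kernel of a character $\chi$ is $\ker\chi=\{g\in G:\chi(g)=\chi(1)\}$. *)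

(* Defs.v *)
From HB Require Import structures.
From mathcomp Require Import all_boot all_order all_algebra.
From mathcomp Require Import all_fingroup all_solvable all_field all_character.

Set Implicit Arguments.
Unset Strict Implicit.
Unset Printing Implicit Defensive.

Import Order.TTheory GRing.Theory Num.Theory GroupScope.
Local Open Scope group_scope.
Local Open Scope ring_scope.

(* The set of supercharacters is a duplicate-free sequence; the superclasses
   form a partition of G. The library's [character] predicate also holds of
   the zero class function, which is not the character of a representation on
   a nonzero space, hence the [chi != 0] condition. *)
Record supercharacter_theory (gT : finGroupType) (G : {group gT})
    (S : seq 'CF(G)) (Sv : {set {set gT}}) : Prop := SupercharacterTheory {
  sct_uniq : uniq S;
  sct_char : {in S, forall chi, chi \is a character /\ chi != 0};
  sct_partition : partition Sv G;
  sct_card : size S = #|Sv|;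
  sct_constt : forall i : Iirr G,
    exists! chi : 'CF(G), chi \in S /\ i \in irr_constt chi;
  sct_const : forall (chi : 'CF(G)) (K : {set gT}), chi \in S -> K \in Sv ->
    {in K &, forall x y, chi x = chi y};
  sct_one : [set 1%g] \in Sv
}.

Definition supernormal (gT : finGroupType) (Sv : {set {set gT}})
    (H : {set gT}) : Prop :=
  exists P : {set {set gT}}, P \subset Sv /\ H = cover P.

Definition char_ker (gT : finGroupType) (G : {group gT}) (chi : 'CF(G)) :
    {set gT} :=
  [set g in G | chi g == chi 1%g].

(* The library's [cfker] is the set of translation periods of a class
   function; for characters the two notions coincide. *)
Lemma char_ker_cfker (gT : finGroupType) (G : {group gT}) (chi : 'CF(G)) :
  chi \is a character -> char_ker chi = cfker chi.
Proof. by move=> Nchi; rewrite cfkerEchar. Qed.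

(* Main.v *)
Require Import Defs.
From HB Require Import structures.
From mathcomp Require Import all_boot all_order all_algebra.
From mathcomp Require Import all_fingroup all_solvable all_field all_character.

Set Implicit Arguments.
Unset Strict Implicit.
Unset Printing Implicit Defensive.

Import Order.TTheory GRing.Theory Num.Theory GroupScope.
Local Open Scope group_scope.
Local Open Scope ring_scope.

(** A class function is constant on the superclasses exactly when it is a
    linear combination of supercharacters: distinct supercharacters have no
    common constituent, hence they are linearly independent
    ([cfdot_sum_supercharacters]), and there are as many of them as there are
    superclasses, so they span all the functions on G that are constant on
    superclasses ([supercharacters_span]).

    If H is a union of superclasses, its indicator function is such a function.
    It is then a class function, so H is normal in G, and it is a positive
    multiple of the permutation character of G / H. Hence its constituents are
    the irreducible characters whose kernel contains H
    ([irr_constt_cfuni_normal]). The coefficients of a constituent in the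
    indicator and in its supercharacter chi differ by a factor that depends on
    chi only, so either all the constituents of chi contain H in their kernels
    or none does ([supernormal_sub_cfker]). So the irreducible characters with
    H in their kernels, whose kernels meet in H, are the constituents of the
    supercharacters with H in their kernels, and the kernels of these meet in H
    as well ([supernormal_bigcap_cfker]).

    Conversely a supercharacter is constant on each superclass, which therefore
    lies in its kernel as soon as it meets it. *)

Section Supercharacters.

Variables (gT : finGroupType) (G : {group gT}).
Variables (S : seq 'CF(G)) (Sv : {set {set gT}}).
Hypothesis sctG : supercharacter_theory S Sv.

Lemma mem_supercharacter (k : 'I_(size S)) : S`_k \in S.
Proof. exact: mem_nth. Qed.

Lemma supercharacter_of_irr (i : Iirr G) :
  exists k : 'I_(size S), i \in irr_constt S`_k.
Proof.
have [chi [[Schi chi_i] _]] := sct_constt sctG i.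
have lt_k: (index chi S < size S)%N by rewrite index_mem.
by exists (Ordinal lt_k); rewrite /= nth_index.
Qed.

Lemma supercharacter_constt_inj (i : Iirr G) (k l : 'I_(size S)) :
  i \in irr_constt S`_k -> i \in irr_constt S`_l -> k = l.
Proof.
move=> Ski Sli; have [chi [_ chi_uniq]] := sct_constt sctG i.
apply/val_inj/eqP; rewrite -(nth_uniq 0 _ _ (sct_uniq sctG)) //=.
by rewrite -(chi_uniq S`_k) ?(chi_uniq S`_l) // mem_supercharacter.
Qed.

(** Distinct supercharacters have disjoint sets of constituents, so pairing a
    combination with a constituent of [S`_k] isolates the coefficient of
    [S`_k]. *)
Lemma cfdot_sum_supercharacters (c : 'I_(size S) -> algC)
    (k : 'I_(size S)) (i : Iirr G) :
    i \in irr_constt S`_k ->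
  '[\sum_l c l *: S`_l, 'chi_i] = c k * '[S`_k, 'chi_i].
Proof.
move=> Ski; rewrite cfdot_suml (bigD1 k) //= big1 ?addr0 ?cfdotZl // => l k'l.
rewrite cfdotZl; have [-> | ] := eqVneq '[S`_l, 'chi_i] 0.
  by rewrite mulr0.
rewrite -irr_consttE => Sli.
by rewrite (supercharacter_constt_inj Sli Ski) eqxx in k'l.
Qed.

Lemma supercharacters_free (c : 'I_(size S) -> algC) :
  \sum_l c l *: S`_l = 0 -> forall k, c k = 0.
Proof.
move=> c0 k; have [_ /neq0_has_constt[i Ski]] :=
  sct_char sctG (mem_supercharacter k).
have /esym/eqP := cfdot_sum_supercharacters c Ski.
rewrite irr_consttE in Ski.
by rewrite c0 cfdot0l mulf_eq0 (negPf Ski) orbF => /eqP.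
Qed.

Lemma superclass_of_mem (g : gT) :
  g \in G -> exists2 K, K \in Sv & g \in K.
Proof.
by rewrite -(cover_partition (sct_partition sctG)) => /bigcupP[K]; exists K.
Qed.

Lemma superclass_repr (K : {set gT}) : K \in Sv -> repr K \in K.
Proof.
have /and3P[_ _ Sv0] := sct_partition sctG.
move=> SvK; have [K0 | [x /mem_repr //]] := set_0Vmem K.
by rewrite -K0 SvK in Sv0.
Qed.

(** The matrix of the values of the supercharacters on the superclasses has
    independent rows because the supercharacters are independent, and it is
    square, so its rows span. *)
Lemma supercharacters_span (f : gT -> algC) :
    (forall K, K \in Sv -> {in K &, forall x y, f x = f y}) ->
  exists c : 'I_(size S) -> algC, {in G, f =1 \sum_l c l *: S`_l}.
Proof.
move=> f_const.
pose M := \matrix_(k < size S, j < #|Sv|) S`_k (repr (enum_val j)).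
pose d := \row_(j < #|Sv|) f (repr (enum_val j)).
have evalM (v : 'rV_(size S)) g K (SvK : K \in Sv) : g \in K ->
  (\sum_l v 0 l *: S`_l) g = (v *m M) 0 (enum_rank_in SvK K).
- move=> Kg; rewrite sum_cfunE mxE; apply: eq_bigr => l _.
  rewrite cfunE mxE enum_rankK_in //; congr (_ * _).
  by apply: (sct_const sctG (mem_supercharacter l) SvK); rewrite ?superclass_repr.
have freeM: row_free M.
  apply: inj_row_free => v vM0; apply/rowP=> k; rewrite [RHS]mxE.
  apply: (supercharacters_free (c := v 0)); apply/cfun_inP => g Gg.
  have [K SvK Kg] := superclass_of_mem Gg.
  by rewrite (evalM v g K SvK) // vM0 mxE cfunE.
have fullM: row_full M by rewrite /row_full (eqP freeM) (sct_card sctG).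
have /submxP[v Dd] := submx_full d fullM.
exists (v 0) => g Gg; have [K SvK Kg] := superclass_of_mem Gg.
rewrite (evalM v g K SvK) // -Dd mxE enum_rankK_in //.
by apply: f_const Kg _; rewrite ?superclass_repr.
Qed.

Lemma supernormal_superclass (H K : {set gT}) (x y : gT) :
  supernormal Sv H -> K \in Sv -> x \in K -> y \in K -> x \in H -> y \in H.
Proof.
case=> P [/subsetP sPSv ->] SvK Kx Ky /bigcupP[L PL Lx].
have /and3P[_ tiSv _] := sct_partition sctG.
apply/bigcupP; exists L => //.
by rewrite -(def_pblock tiSv (sPSv _ PL) Lx) (def_pblock tiSv SvK Kx).
Qed.

(** A combination of supercharacters is a class function; when it is the
    indicator function of H on G, its invariance under conjugation is the
    normality of H. *)
Lemma supernormal_cfuni (H : {group gT}) :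
    H \subset G -> supernormal Sv H ->
  H <| G /\ exists c : 'I_(size S) -> algC, '1_H = \sum_l c l *: S`_l.
Proof.
move=> sHG nH.
have indH_const K : K \in Sv ->
  {in K &, forall x y, (x \in H)%:R = (y \in H)%:R :> algC}.
- move=> SvK x y Kx Ky; congr (nat_of_bool _)%:R.
  by apply/idP/idP; apply: supernormal_superclass nH SvK _ _.
have [c Dc] := supercharacters_span indH_const.
have nsHG: H <| G.
  rewrite /normal sHG; apply/subsetP=> x Gx; rewrite inE.
  apply/subsetP=> _ /imsetP[h Hh ->]; have Gh := subsetP sHG h Hh.
  have /eqP := Dc _ (groupJ Gh Gx); rewrite cfunJ // -Dc // Hh.
  by case: (_ \in H); rewrite // eq_sym oner_eq0.
split=> //; exists c; apply/cfun_inP=> g Gg.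
by rewrite cfuniE // Dc.
Qed.

End Supercharacters.

(** Up to the factor [#|G : H|], the indicator function of H is the character
    that the principal character of H induces, and Frobenius reciprocity
    applies. *)
Lemma irr_constt_cfuni_normal (gT : finGroupType) (G H : {group gT})
    (i : Iirr G) :
  H <| G -> (i \in irr_constt ('1_H : 'CF(G))) = (H \subset cfker 'chi_i).
Proof.
move=> nsHG; have sHG := normal_sub nsHG.
have idxH: '['Res[H] 'chi_i, 'chi_0] != 0 = (i \in irr_constt ('1_H : 'CF(G))).
  rewrite irr0 cfdotC conjC_eq0 cfdot_Res_r cfInd_cfun1 // cfdotZl irr_consttE.
  by rewrite mulf_eq0 pnatr_eq0 (gtn_eqF (indexg_gt0 G H)).
rewrite -idxH; apply/idP/idP=> [Res1 | kerH].
  by apply: constt0_Res_cfker => //; rewrite irr_consttE.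
by rewrite cfRes_sub_ker // cfdotZl irr0 cfnorm1 mulr1 irr1_neq0.
Qed.

Section Supernormal.

Variables (gT : finGroupType) (G : {group gT}).
Variables (S : seq 'CF(G)) (Sv : {set {set gT}}).
Hypothesis sctG : supercharacter_theory S Sv.
Variable H : {group gT}.
Hypotheses (sHG : H \subset G) (snH : supernormal Sv H).

(** A supercharacter [S`_k] has a constituent with H in its kernel if and only
    if its coefficient in the indicator function of H is nonzero; this
    criterion does not depend on the constituent. *)
Lemma supernormal_sub_cfker (k : 'I_(size S)) (i : Iirr G) :
  i \in irr_constt S`_k -> H \subset cfker 'chi_i -> H \subset cfker S`_k.
Proof.
have [nsHG [c Dc]] := supernormal_cfuni sctG sHG snH.
have kerHE j: j \in irr_constt S`_k -> (H \subset cfker 'chi_j) = (c k != 0).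
  move=> Skj; rewrite -irr_constt_cfuni_normal // irr_consttE Dc.
  rewrite (cfdot_sum_supercharacters sctG c Skj) mulf_eq0 negb_or.
  by rewrite -irr_consttE Skj andbT.
move=> Ski; rewrite (kerHE i Ski) => ck_neq0.
have [Nchi _] := sct_char sctG (mem_supercharacter k).
rewrite cfkerE // subsetI sHG; apply/bigcapsP=> j Skj.
by rewrite (kerHE j Skj).
Qed.

(** A normal subgroup is the intersection of the kernels of the irreducible
    characters lifted from the quotient, and each of these kernels contains the kernel
    of the supercharacter in which the irreducible character appears. *)
Lemma supernormal_bigcap_cfker (g : gT) :
    (forall chi, chi \in S -> H \subset cfker chi -> g \in cfker chi) ->
  g \in H.
Proof.
have [nsHG _] := supernormal_cfuni sctG sHG snH.
move=> kerg; rewrite -(cap_cfker_normal nsHG); apply/bigcapP=> i kerH.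
have [k Ski] := supercharacter_of_irr sctG i.
have [Nchi _] := sct_char sctG (mem_supercharacter k).
apply: (subsetP (cfker_constt Nchi Ski)); apply: kerg.
  exact: mem_supercharacter.
exact: supernormal_sub_cfker Ski kerH.
Qed.

End Supernormal.

Theorem proposition2p1 (gT : finGroupType) (G : {group gT})
    (S : seq 'CF(G)) (Sv : {set {set gT}})
    (sctG : supercharacter_theory S Sv)
    (H : {group gT}) (sHG : H \subset G) :
  supernormal Sv H <->
  exists (n : nat) (chi : 'I_n.+1 -> 'CF(G)),
    (forall i, chi i \in S) /\ H :=: \bigcap_(i < n.+1) char_ker (chi i).
Proof.
split=> [snH | [n [chi [Schi defH]]]].
  pose t := [seq chi <- S | H \subset cfker chi].
  (* The supercharacter that has the principal character as a constituent
     belongs to t, because the kernel of the latter is all of G. *)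
  have t_gt0: (0 < size t)%N.
    have [k Sk0] := supercharacter_of_irr sctG 0.
    rewrite lt0n size_eq0 -has_filter; apply/hasP; exists S`_k.
      exact: mem_supercharacter.
    by apply: (supernormal_sub_cfker sctG sHG snH Sk0); rewrite cfker_irr0.
  have t_mem (i : 'I_(size t).-1.+1) : t`_i \in t.
    by rewrite mem_nth // -[X in (_ < X)%N](prednK t_gt0).
  have t_S chi: chi \in t -> H \subset cfker chi /\ chi \in S.
    by rewrite mem_filter => /andP.
  exists (size t).-1, (fun i => t`_i).
  split=> [i | ]; first by case: (t_S _ (t_mem i)).
  have kerE (i : 'I_(size t).-1.+1) : char_ker t`_i = cfker t`_i.
    by apply: char_ker_cfker; have [_ /(sct_char sctG)[]] := t_S _ (t_mem i).
  apply/setP=> g; apply/idP/bigcapP=> [Hg i _ | kerg].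
    by rewrite kerE //; have [/subsetP->] := t_S _ (t_mem i).
  apply: (supernormal_bigcap_cfker sctG sHG snH) => chi Schi kerH.
  have t_chi: chi \in t by rewrite mem_filter kerH.
  have lt_i: (index chi t < (size t).-1.+1)%N by rewrite prednK // index_mem.
  by have := kerg (Ordinal lt_i) isT; rewrite kerE /= nth_index.
exists [set K in Sv | K \subset H]; split.
  by apply/subsetP=> K; rewrite inE => /andP[].
apply/setP=> g; apply/idP/bigcupP=> [Hg | [K]]; last first.
  by rewrite inE => /andP[_ /subsetP]; apply.
have [K SvK Kg] := superclass_of_mem sctG (subsetP sHG g Hg).
exists K => //; rewrite inE SvK; apply/subsetP=> y Ky.
have Gy: y \in G.
  by rewrite -(cover_partition (sct_partition sctG)); apply/bigcupP; exists K.
rewrite defH in Hg *; apply/bigcapP=> i _; have /bigcapP/(_ i isT) := Hg.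
rewrite !inE Gy => /andP[_ /eqP <-].
by apply/eqP/(sct_const sctG (Schi i) SvK Ky Kg).
Qed.
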